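(* There exists a family of bipartite graphs $G_n=(V_1\cup V_2,E)$, with number of vertices polynomial in $n$, such that the extension complexity of the maximal matching polytope $MM(G_n)$ is not bounded by any polynomial in $n$.
   Context: A matching in $G=(V,E)$ is maximal if it is not properly contained in another matching of $G$. The maximal matching polytope $MM(G)$ is the convex hull of the 0/1 incidence vectors in $\mathbb{R}^E$ of all maximal matchings of $G$. The extension complexity $\mathrm{xc}(Q)$ of a polytope $Q$ is the minimum number of facets of a polytope $Q'$ such that $Q$ is a linear image of $Q'$. *)

(* Defs.v *)
From Stdlib Require Import Reals.
From mathcomp Require Import all_boot.

Set Implicit Arguments.
Unset Strict Implicit.
Unset Printing Implicit Defensive.

Local Open Scope R_scope.

Definition vec (I : finType) := I -> R.

Definition rsum (I : finType) (f : I -> R) : R := \big[Rplus/R0]_(i : I) f i.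

Definition dot (I : finType) (a x : vec I) : R := rsum (fun i => (a i * x i)).

Definition vzero (I : finType) : vec I := fun _ => R0.

Definition conv (I : finType) (X : seq (vec I)) : vec I -> Prop :=
  fun x => exists lam : 'I_(size X) -> R,
    (forall j, (0 <= lam j)) /\ rsum lam = 1 /\
    forall i, x i = rsum (fun j => (lam j * nth (@vzero I) X j i)).

Definition is_polytope (I : finType) (P : vec I -> Prop) : Prop :=
  exists X : seq (vec I), forall x, P x <-> conv X x.

Definition aff_indep (I : finType) (ps : seq (vec I)) : Prop :=
  forall mu : 'I_(size ps) -> R,
    rsum mu = 0 ->
    (forall i, rsum (fun j => (mu j * nth (@vzero I) ps j i)) = 0) ->
    forall j, mu j = 0.

Definition rank_ge (I : finType) (P : vec I -> Prop) (r : nat) : Prop :=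
  exists ps : seq (vec I), size ps = r /\
    (forall j : 'I_(size ps), P (nth (@vzero I) ps j)) /\ aff_indep ps.

(* The maximal number of affinely independent points of P is r,
   i.e. dim P = r - 1 (the empty set has r = 0, dimension -1). *)
Definition has_rank (I : finType) (P : vec I -> Prop) (r : nat) : Prop :=
  rank_ge P r /\ ~ rank_ge P r.+1.

Definition is_face (I : finType) (P F : vec I -> Prop) : Prop :=
  exists (a : vec I) (b : R),
    (forall x, P x -> (dot a x <= b)) /\
    forall x, F x <-> (P x /\ dot a x = b).

Definition is_facet (I : finType) (P F : vec I -> Prop) : Prop :=
  is_face P F /\ exists r, has_rank P r.+1 /\ has_rank F r.

Definition at_most_facets (I : finType) (P : vec I -> Prop) (m : nat) : Prop :=
  exists Fs : seq (vec I -> Prop), (size Fs <= m)%N /\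
    forall F, is_facet P F ->
      exists j : 'I_(size Fs), forall x, F x <-> nth (fun _ => False) Fs j x.

Definition lin_image (I J : finType) (C : I -> J -> R)
    (P : vec J -> Prop) (Q : vec I -> Prop) : Prop :=
  forall y, Q y <-> exists x, P x /\ forall i, y i = rsum (fun j => (C i j * x j)).

Definition xc_le (I : finType) (Q : vec I -> Prop) (m : nat) : Prop :=
  exists (k : nat) (P : vec 'I_k -> Prop),
    is_polytope P /\ at_most_facets P m /\
    exists C : I -> 'I_k -> R, lin_image C P Q.

Definition simple_graph (T : finType) (E : {set {set T}}) : bool :=
  [forall e in E, #|e| == 2%N].

(* bipartite: V = V1 ∪ V2 (V2 = complement of V1), every edge has exactly
   one endpoint in V1 *)
Definition bipartite (T : finType) (E : {set {set T}}) : Prop :=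
  exists V1 : {set T}, forall e, e \in E -> #|e :&: V1| = 1%N.

Definition is_matching (T : finType) (E M : {set {set T}}) : bool :=
  (M \subset E) &&
  [forall e in M, forall f in M, (e != f) ==> [disjoint e & f]].

Definition is_maximal_matching (T : finType) (E M : {set {set T}}) : bool :=
  is_matching E M &&
  [forall M' : {set {set T}}, (is_matching E M' && (M \subset M')) ==> (M' == M)].

Definition edge (T : finType) (E : {set {set T}}) : finType := {e : {set T} | e \in E}.

Definition incidence (T : finType) (E M : {set {set T}}) : vec (edge E) :=
  fun e => if val e \in M then R1 else R0.

Definition MM (T : finType) (E : {set {set T}}) : vec (edge E) -> Prop :=
  conv (map (@incidence T E) (enum [set M : {set {set T}} | is_maximal_matching E M])).

Arguments MM {T} E.
Arguments incidence {T} E M.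
Arguments edge {T} E.

(* Main.v *)
Require Import Defs.
From Stdlib Require Import Reals.
From mathcomp Require Import all_boot all_order all_algebra.
From mathcomp Require Import boolp Rstruct ring lra zify.

Set Implicit Arguments.
Unset Strict Implicit.
Unset Printing Implicit Defensive.

(* Maximality of a matching forces every edge to have a matched endpoint.  In a
   bipartite graph with O(n^2) vertices this makes it possible to encode 0/1
   vectors b of length n by maximal matchings M_b, and to find for each 0/1 vector
   a a valid inequality of the polytope whose slack at M_b is (1 - |a /\ b|)^2.

   If the polytope is a projection of a polytope P with m facets, then each
   facet of P yields a rectangle, and the m rectangles cover exactly the pairs
   (a, b) with nonzero slack, because every face of P is an intersection of
   facets.  By the argument of Kaibel and Weltge, a rectangle that avoids all
   pairs with |a /\ b| = 1 contains at most 2^n of the 3^n disjoint pairs, hence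
   m >= (3/2)^n. *)

(** * Covering disjoint pairs by rectangles *)

(** Sum over the [3 ^ n] pairs of disjoint 0/1 strings of length [n]: at each position every pair of
    bits but [(true, true)] is allowed. The recursive form suits the induction on [n] below. *)
Fixpoint disjoint_sum (n : nat) (f : bitseq -> bitseq -> nat) : nat :=
  if n is n'.+1 then
    disjoint_sum n' (fun a b => f (false :: a) (false :: b)) +
    disjoint_sum n' (fun a b => f (true :: a) (false :: b)) +
    disjoint_sum n' (fun a b => f (false :: a) (true :: b))
  else f [::] [::].

Definition common (a b : bitseq) : nat := count (fun p => p.1 && p.2) (zip a b).

Lemma leq_disjoint_sum n (f g : bitseq -> bitseq -> nat) :
    (forall a b, size a = n -> size b = n -> common a b = 0 -> f a b <= g a b) ->
  disjoint_sum n f <= disjoint_sum n g.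
Proof.
elim: n f g => [|n IHn] f g le_fg /=; first exact: le_fg.
rewrite !leq_add //; apply: IHn => a b sa sb ab0;
  by apply: le_fg; rewrite /= ?sa ?sb //.
Qed.

Lemma disjoint_sumD n (f g : bitseq -> bitseq -> nat) :
  disjoint_sum n (fun a b => f a b + g a b) = disjoint_sum n f + disjoint_sum n g.
Proof. by elim: n f g => [|n IHn] f g //=; rewrite !IHn; lia. Qed.

Lemma disjoint_sum_const n c : disjoint_sum n (fun _ _ => c) = 3 ^ n * c.
Proof. by elim: n => [|n IHn] /=; rewrite ?mul1n // IHn expnS; lia. Qed.

Lemma disjoint_sum_big n m (f : 'I_m -> bitseq -> bitseq -> nat) :
  disjoint_sum n (fun a b => \sum_(j < m) f j a b) = \sum_(j < m) disjoint_sum n (f j).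
Proof.
elim: n f => [|n IHn] f //=.
by rewrite (IHn (fun j a b => f j (false :: a) (false :: b)))
  (IHn (fun j a b => f j (true :: a) (false :: b)))
  (IHn (fun j a b => f j (false :: a) (true :: b))) -!big_split.
Qed.

(* Kaibel-Weltge: if a and b are disjoint, then not both 1a in A and 1b in B; so
   the three kinds of disjoint extensions of (a, b) are counted by the two
   rectangles (A0 u A1) x B0 and A0 x (B0 u B1). *)
Lemma disjoint_sum_rectangle n (A B : pred bitseq) :
    (forall a b, size a = n -> size b = n -> common a b = 1 -> ~~ (A a && B b)) ->
  disjoint_sum n (fun a b => A a && B b) <= 2 ^ n.
Proof.
elim: n A B => [|n IHn] A B noAB /=; first by case: (_ && _).
pose A0 a := A (false :: a); pose A1 a := A (true :: a).
pose B0 b := B (false :: b); pose B1 b := B (true :: b).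
apply: (@leq_trans (disjoint_sum n (fun a b => (A0 a || A1 a) && B0 b) +
                    disjoint_sum n (fun a b => A0 a && (B0 b || B1 b)))).
  rewrite -!disjoint_sumD; apply: leq_disjoint_sum => a b sa sb ab0.
  have := noAB (true :: a) (true :: b); rewrite /common /= sa sb -/(common a b) ab0.
  move/(_ erefl erefl erefl); rewrite /A0 /A1 /B0 /B1.
  by case: (A _); case: (A _); case: (B _); case: (B _).
rewrite expnS mul2n -addnn leq_add //; apply: IHn => a b sa sb ab1.
  have := noAB (false :: a) (false :: b); have := noAB (true :: a) (false :: b).
  rewrite /common /= sa sb -/(common a b) ab1 => /(_ erefl erefl erefl) N1.
  move=> /(_ erefl erefl erefl); move: N1; rewrite /A0 /A1 /B0.
  by case: (A _); case: (A _); case: (B _).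
have := noAB (false :: a) (false :: b); have := noAB (false :: a) (true :: b).
rewrite /common /= sa sb -/(common a b) ab1 => /(_ erefl erefl erefl) N1.
move=> /(_ erefl erefl erefl); move: N1; rewrite /A0 /B0 /B1.
by case: (A _); case: (B _); case: (B _).
Qed.

Lemma rectangle_cover_bound n m (A B : 'I_m -> pred bitseq) :
    (forall j a b, size a = n -> size b = n -> common a b = 1 ->
       ~~ (A j a && B j b)) ->
    (forall a b, size a = n -> size b = n -> common a b = 0 ->
       exists j, A j a && B j b) ->
  3 ^ n <= m * 2 ^ n.
Proof.
move=> noAB cover; rewrite -[3 ^ n]muln1 -disjoint_sum_const.
have le1 : disjoint_sum n (fun _ _ => 1) <=
    disjoint_sum n (fun a b => \sum_(j < m) (A j a && B j b)).
  apply: leq_disjoint_sum => a b sa sb ab0; have [j ABj] := cover a b sa sb ab0.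
  by rewrite (bigD1 j) //= ABj.
apply: leq_trans le1 _; rewrite disjoint_sum_big -[m in m * _]card_ord -sum_nat_const.
by apply: leq_sum => j _; apply: disjoint_sum_rectangle; apply: noAB.
Qed.

Lemma poly_lt_exp c d : exists n, (c * n ^ d + c) * 2 ^ n < 3 ^ n.
Proof.
(* With [n = m.*2 = 2 ^ k.+1] a power of two, the polynomial is at most [2 ^ (1 + c + k.+1 * d)],
   and [s] is chosen so that this exponent is at most [k.+1 * s < 2 ^ k = m]. *)
pose s := c + d + 1; pose k := (2 * s).*2; pose m := 2 ^ k.
exists m.*2.
(* This is [8 ^ m <= 9 ^ m]; it remains to keep the polynomial below [2 ^ m]. *)
have le9 : 2 ^ m * 2 ^ m.*2 <= 3 ^ m.*2.
  by rewrite -muln2 [m * 2]mulnC !expnM -expnMn leq_exp2r ?expn_gt0.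
apply: leq_trans le9; rewrite ltn_pmul2r ?expn_gt0 //.
have ltk : k.+1 * s < 2 ^ k.
  have := ltn_expl (2 * s) (ltnSn 1); rewrite {2}/k -addnn expnD.
  by rewrite /k; nia.
apply: (@leq_ltn_trans (2 ^ (k.+1 * s))); last by rewrite ltn_exp2l.
have le_c : c <= 2 ^ c by apply: ltnW; apply: ltn_expl.
have -> : m.*2 = 2 ^ k.+1 by rewrite -mul2n -expnS.
rewrite -expnM; apply: (@leq_trans (2 * (c * 2 ^ (k.+1 * d)))).
  have : 0 < 2 ^ (k.+1 * d) by rewrite expn_gt0.
  by nia.
apply: (@leq_trans (2 ^ (1 + c + k.+1 * d))).
  by rewrite !expnD expn1 -mulnA leq_mul2l /= leq_mul2r le_c orbT.
by rewrite leq_exp2l // /s; nia.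
Qed.

(** * Maximal matchings of bipartite graphs *)

Section BipartiteGraph.

Variables (S T : finType) (adj : S -> T -> bool).

Notation vertex := 'I_#|{: S + T}|.

(** Vertices are ranks in the enumeration of [S + T], because the theorem asks for graphs on
    ['I_(N n)]. *)
Definition link (s : S) (t : T) : {set vertex} :=
  [set enum_rank (inl s : S + T); enum_rank (inr t : S + T)].

Definition links (m : S -> T -> bool) : {set {set vertex}} :=
  [set link p.1 p.2 | p in [pred p | m p.1 p.2]].

Lemma link_inj s t s' t' : link s t = link s' t' -> s = s' /\ t = t'.
Proof.
move=> eq_st; split.
  have: enum_rank (inl s : S + T) \in link s' t' by rewrite -eq_st !inE eqxx.
  by rewrite !inE !(inj_eq enum_rank_inj) orbF => /eqP[].
have: enum_rank (inr t : S + T) \in link s' t' by rewrite -eq_st !inE eqxx orbT.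
by rewrite !inE !(inj_eq enum_rank_inj) => /eqP[].
Qed.

Lemma mem_links m s t : (link s t \in links m) = m s t.
Proof.
apply/imsetP/idP => [[[s' t'] /= m'] /link_inj[-> ->] //|mst].
by exists (s, t).
Qed.

Lemma linksP (m : S -> T -> bool) e :
  reflect (exists s t, m s t /\ e = link s t) (e \in links m).
Proof.
apply: (iffP imsetP) => [[[s t] mst ->]|[s [t [mst ->]]]]; first by exists s, t.
by exists (s, t).
Qed.

Lemma link_disjoint s t s' t' :
  [disjoint link s t & link s' t'] = (s != s') && (t != t').
Proof.
by rewrite disjoints_subset subUset !sub1set !inE !(inj_eq enum_rank_inj) /= orbF.
Qed.

Lemma simple_links m : simple_graph (links m).
Proof.
apply/forall_inP => e /linksP[s [t [_ ->]]].
by rewrite cards2 (inj_eq enum_rank_inj).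
Qed.

Lemma bipartite_links m : bipartite (links m).
Proof.
exists [set enum_rank (inl s : S + T) | s : S] => e /linksP[s [t [_ ->]]].
rewrite (_ : _ :&: _ = [set enum_rank (inl s : S + T)]) ?cards1 //.
apply/setP => v; rewrite !inE; apply/andP/eqP => [[/orP[/eqP -> //|/eqP ->]]|->].
  by case/imsetP => s' _ /enum_rank_inj.
by rewrite eqxx; split=> //; apply: imset_f.
Qed.

Lemma matching_eqr M s t t' : is_matching (links adj) M ->
  link s t \in M -> link s t' \in M -> t = t'.
Proof.
case/andP=> _ /forall_inP disjM Mt Mt'; apply/eqP.
have := forall_inP (disjM _ Mt) _ Mt'; rewrite link_disjoint eqxx implybF negbK.
by case/eqP/link_inj => _ ->.
Qed.

Lemma matching_eql M s s' t : is_matching (links adj) M ->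
  link s t \in M -> link s' t \in M -> s = s'.
Proof.
case/andP=> _ /forall_inP disjM Ms Ms'; apply/eqP.
have := forall_inP (disjM _ Ms) _ Ms'.
rewrite link_disjoint eqxx andbF implybF negbK.
by case/eqP/link_inj => ->.
Qed.

Lemma matching_adj M s t : is_matching (links adj) M -> link s t \in M -> adj s t.
Proof. by case/andP=> /subsetP sME _ /sME; rewrite mem_links. Qed.

(** Otherwise [link s t] could be added to [M]. *)
Lemma maximal_matching_cover M s t :
    is_maximal_matching (links adj) M -> adj s t ->
  [exists t', link s t' \in M] || [exists s', link s' t \in M].
Proof.
case/andP=> matM /forallP maxM adj_st; apply/negPn; rewrite negb_or.
apply/negP => /andP[/existsPn freeS /existsPn freeT].
have disj e : e \in M -> [disjoint link s t & e].
  move=> Me; have [/subsetP/(_ _ Me)/linksP[s' [t' [_ def_e]]] _] := andP matM.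
  rewrite {}def_e in Me *; rewrite link_disjoint; apply/andP; split.
    by apply: contraTneq Me => <-; apply: freeS.
  by apply: contraTneq Me => <-; apply: freeT.
have /implyP := maxM (link s t |: M); rewrite subsetUr andbT => maxM'.
suff /maxM'/eqP defM : is_matching (links adj) (link s t |: M).
  by have /negP := freeS t; apply; rewrite -defM setU11.
have [sME /forall_inP disjM] := andP matM.
apply/andP; split; first by rewrite subUset sub1set mem_links adj_st.
apply/forall_inP => e /setU1P[->|Me]; apply/forall_inP => f /setU1P[->|Mf];
  apply/implyP.
- by rewrite eqxx.
- by move=> _; apply: disj.
- by move=> _; rewrite disjoint_sym; apply: disj.
- by apply/implyP; apply: (forall_inP (disjM e Me)).
Qed.

(** An edge of a larger matching has an endpoint covered by [m], and the two edges of that matching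
    at this endpoint must coincide. *)
Lemma links_maximal_matching (m : S -> T -> bool) :
    (forall s t, m s t -> adj s t) ->
    (forall s t t', m s t -> m s t' -> t = t') ->
    (forall s s' t, m s t -> m s' t -> s = s') ->
    (forall s t, adj s t -> (exists t', m s t') \/ (exists s', m s' t)) ->
  is_maximal_matching (links adj) (links m).
Proof.
move=> m_adj m_r m_l m_cover; apply/andP; split.
  apply/andP; split.
    by apply/subsetP => e /linksP[s [t [mst ->]]]; rewrite mem_links m_adj.
  apply/forall_inP => e /linksP[s [t [mst ->]]].
  apply/forall_inP => f /linksP[s' [t' [mst' ->]]].
  apply/implyP; rewrite link_disjoint => ne; apply/andP; split.
    apply: contraNneq ne => eqs; rewrite -eqs in mst' *.
    by rewrite (m_r _ _ _ mst mst').
  apply: contraNneq ne => eqt; rewrite -eqt in mst' *.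
  by rewrite (m_l _ _ _ mst mst').
apply/forallP => M'; apply/implyP => /andP[matM' sMM'].
rewrite eqEsubset sMM' andbT; apply/subsetP => e M'e.
have /linksP[s [t [adj_st def_e]]] : e \in links adj.
  by have [/subsetP->] := andP matM'.
rewrite {}def_e in M'e *; rewrite mem_links.
have inM' s1 t1 : m s1 t1 -> link s1 t1 \in M'.
  by move=> m1; rewrite (subsetP sMM') ?mem_links.
have [[t' mt']|[s' ms']] := m_cover s t adj_st.
  by rewrite (matching_eqr matM' M'e (inM' _ _ mt')).
by rewrite (matching_eql matM' M'e (inM' _ _ ms')).
Qed.

End BipartiteGraph.

(** * Facets of polytopes and extension complexity *)

Section Polytopes.

Import Order.TTheory GRing.Theory Num.Theory.
Local Open Scope ring_scope.

Lemma rsumE (I : finType) (f : I -> R) : rsum f = \sum_i f i.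
Proof. by []. Qed.

Lemma dotE (I : finType) (a x : vec I) : dot a x = \sum_i a i * x i.
Proof. by []. Qed.

Lemma conv_nth (I : finType) (X : seq (vec I)) (j : 'I_(size X)) :
  conv X (nth (@vzero I) X j).
Proof.
exists (fun i => (i == j)%:R); split=> [i|].
  by apply/RleP; case: eqP.
split=> [|i].
  by rewrite rsumE (bigD1 j) //= eqxx big1 ?addr0 // => i /negPf->.
rewrite rsumE (bigD1 j) //= eqxx big1 => [|i' /negPf->]; last exact: mul0r.
by rewrite addr0; apply/esym/mul1r.
Qed.


(** The shape [d - dot c x] is the slack of an inequality [dot c x <= d], as in [is_face]. *)
Definition affine (I : finType) (f : vec I -> R) : Prop :=
  exists c d, forall x, f x = d - dot c x.

Section Affine.

Variable I : finType.
Implicit Types (f g : vec I -> R).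

Lemma eq_affine f g : f =1 g -> affine g -> affine f.
Proof. by move=> eq_fg [c [d gE]]; exists c, d => x; rewrite eq_fg. Qed.

Lemma affine_const t : affine (fun _ : vec I => t).
Proof.
exists (fun _ => 0), t => x; rewrite dotE big1 ?subr0 // => i _; exact: mul0r.
Qed.

Lemma affine_coord i : affine (fun x : vec I => x i).
Proof.
exists (fun j => - (j == i)%:R), 0 => x; rewrite dotE (bigD1 i) //= eqxx big1.
  by rewrite addr0 sub0r mulN1r opprK.
by move=> j /negPf->; rewrite oppr0 mul0r.
Qed.

Lemma affineD f g : affine f -> affine g -> affine (fun x => f x + g x).
Proof.
move=> [c [d fE]] [c' [d' gE]]; exists (fun i => c i + c' i), (d + d') => x.
rewrite fE gE !dotE addrACA -opprD -big_split; congr (_ - _).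
by apply: eq_bigr => i _; rewrite /= mulrDl.
Qed.

Lemma affineZ t f : affine f -> affine (fun x => t * f x).
Proof.
case=> c [d fE]; exists (fun i => t * c i), (t * d) => x.
rewrite fE !dotE mulrBr mulr_sumr; congr (_ - _).
by apply: eq_bigr => i _; rewrite mulrA.
Qed.

Lemma affineN f : affine f -> affine (fun x => - f x).
Proof. by move=> /(affineZ (-1)); apply: eq_affine => x; rewrite mulN1r. Qed.

Lemma affine_sum (J : finType) (P : pred J) (f : J -> vec I -> R) :
  (forall j, affine (f j)) -> affine (fun x => \sum_(j | P j) f j x).
Proof.
move=> aff_f; elim: (index_enum J) => [|j s IHs].
  by apply: eq_affine (affine_const 0) => x; rewrite big_nil.
case Pj: (P j); last by apply: eq_affine IHs => x; rewrite big_cons Pj.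
by apply: eq_affine (affineD (aff_f j) IHs) => x; rewrite big_cons Pj.
Qed.

Lemma affine_conv_ge0 f (X : seq (vec I)) x : affine f ->
  (forall j : 'I_(size X), 0 <= f (nth (@vzero I) X j)) -> conv X x -> 0 <= f x.
Proof.
move=> [c [d fE]] f_ge0 [lam [lam_ge0 [lam1 xE]]].
suff -> : f x = \sum_j lam j * f (nth (@vzero I) X j).
  by apply: sumr_ge0 => j _; apply: mulr_ge0 => //; apply/RleP/lam_ge0.
under eq_bigr => j _ do rewrite fE mulrBr.
rewrite fE sumrB -mulr_suml -rsumE lam1 mul1r; congr (_ - _).
under [RHS]eq_bigr => j _ do rewrite dotE mulr_sumr.
rewrite exchange_big dotE; apply: eq_bigr => i _.
rewrite xE rsumE mulr_sumr; apply: eq_bigr => j _; exact: mulrCA.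
Qed.

End Affine.

(** * Affine rank through homogeneous coordinates *)

Section Dimension.

Variable k : nat.
Implicit Types (x p : vec 'I_k) (g h w : 'cV[R]_(1 + k)).

(* Affine dependence of points is linear dependence of the vectors (1, x). *)
Definition homog x : 'rV[R]_(1 + k) := row_mx 1 (\row_i x i).

Definition homogs n (y : 'I_n -> vec 'I_k) : 'M[R]_(n, 1 + k) :=
  \matrix_j homog (y j).

Definition aff g x : R := (homog x *m g) 0 0.

Lemma homog_mul x g : homog x *m g = (aff g x)%:M.
Proof. by rewrite /aff -mx11_scalar. Qed.

Lemma row_homogs n (y : 'I_n -> vec 'I_k) j : row j (homogs y) = homog (y j).
Proof. exact: rowK. Qed.

Lemma affE g x : aff g x = g 0 0 - dot (fun i => - g (rshift 1 i) 0) x.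
Proof.
rewrite /aff /homog mxE big_split_ord /= big_ord1 row_mxEl !mxE mul1r.
rewrite (_ : lshift k 0 = 0); last exact: val_inj.
congr (_ + _); rewrite dotE -sumrN; apply: eq_bigr => i _.
by rewrite row_mxEr !mxE mulNr opprK mulrC.
Qed.

Lemma aff_of_dot (a : vec 'I_k) (b : R) : exists g, forall x, aff g x = b - dot a x.
Proof.
exists (col_mx b%:M (\col_i - a i)) => x.
rewrite /aff /homog mul_row_col mul1mx !mxE dotE -sumrN; congr (_ + _).
by apply: eq_bigr => i _; rewrite !mxE mulrN mulrC.
Qed.

Lemma affD g h x : aff (g + h) x = aff g x + aff h x.
Proof. by rewrite /aff mulmxDr mxE. Qed.

Lemma affZ t g x : aff (t *: g) x = t * aff g x.
Proof. by rewrite /aff -scalemxAr mxE. Qed.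

Lemma aff_indepP (ps : seq (vec 'I_k)) :
  aff_indep ps <-> row_free (homogs (fun j : 'I_(size ps) => nth (@vzero _) ps j)).
Proof.
set A := homogs _.
have mulA (v : 'rV_(size ps)) : v *m A =
    row_mx (\sum_j v 0 j)%:M (\row_i \sum_j v 0 j * nth (@vzero _) ps j i).
  rewrite mulmx_sum_row; apply/rowP => i; rewrite summxE.
  rewrite -[i]splitK; case: (split i) => i' /=; rewrite ?row_mxEl ?row_mxEr !mxE.
    rewrite ord1 mulr1n; apply: eq_bigr => j _.
    by rewrite row_homogs mxE row_mxEl !mxE mulr1.
  by apply: eq_bigr => j _; rewrite row_homogs mxE row_mxEr !mxE.
split=> [indep | freeA mu mu0 mu_ps0 j].
  apply: inj_row_free => v /eqP; rewrite mulA -row_mx0 => /eqP/eq_row_mx[v0 vps].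
  apply/rowP => j; rewrite mxE; apply: indep => [|i].
    by have := congr1 (fun M : 'M_1 => M 0 0) v0; rewrite !mxE mulr1n.
  by have := congr1 (fun M : 'rV_k => M 0 i) vps; rewrite !mxE.
have : \row_j mu j *m A = 0 *m A.
  rewrite mul0mx mulA -row_mx0; congr row_mx.
    rewrite (_ : \sum_j _ = 0) ?raddf0 // -[RHS]mu0.
    by apply: eq_bigr => j' _; rewrite mxE.
  apply/rowP => i; rewrite !mxE -[RHS](mu_ps0 i).
  by apply: eq_bigr => j' _; rewrite mxE.
by move/(row_free_inj freeA)/rowP/(_ j); rewrite !mxE.
Qed.

Lemma rank_ge_homogs n (y : 'I_n -> vec 'I_k) (F : vec 'I_k -> Prop) :
  (forall j, F (y j)) -> rank_ge F (\rank (homogs y)).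
Proof.
move=> Fy; set A := homogs y; pose z j := y (maxrankfun A j).
pose ps := [seq z j | j <- enum 'I_(\rank A)].
have sz : size ps = \rank A by rewrite size_map size_enum_ord.
have nth_ps (j : 'I_(size ps)) : nth (@vzero _) ps j = z (cast_ord sz j).
  have j_lt : (j < \rank A)%N by rewrite -sz.
  rewrite (nth_map (cast_ord sz j)) ?size_enum_ord //; congr z.
  by apply: val_inj; rewrite /= nth_enum_ord.
exists ps; split=> //; split=> [j|]; first by rewrite nth_ps; apply: Fy.
apply/aff_indepP.
(* Stated for an arbitrary size [r], so that the equation [e], and with it the cast, can be
   eliminated. *)
have freez r (e : \rank A = r) (w : 'I_r -> vec 'I_k) :
    (forall j, w (cast_ord e j) = z j) -> row_free (homogs w).
  case: r / e w => w wE; suff -> : homogs w = rowsub (maxrankfun A) A.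
    exact: maxrowsub_free.
  apply/row_matrixP => j; rewrite row_rowsub !row_homogs.
  by rewrite -[j in LHS](cast_ord_id erefl) wE.
apply: (freez _ (esym sz)) => j; rewrite nth_ps; congr z; exact: val_inj.
Qed.

(** Affinely independent points of [F] give independent rows in the row space of [homogs y], so
    their number cannot exceed its rank. *)
Lemma has_rank_homogs n (y : 'I_n -> vec 'I_k) (F : vec 'I_k -> Prop) :
    (forall j, F (y j)) -> (forall x, F x -> (homog x <= homogs y)%MS) ->
  has_rank F (\rank (homogs y)).
Proof.
move=> Fy sFy; split; first exact: rank_ge_homogs.
case=> ps [sz [Fps /aff_indepP]]; set A := homogs _; rewrite /row_free => /eqP rA.
have : (A <= homogs y)%MS.
  by apply/row_subP => j; rewrite row_homogs; apply: sFy.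
by move/mxrankS; rewrite rA sz ltnn.
Qed.

End Dimension.

(** * Faces and facets of a convex hull *)

Section Facets.

Variables (k : nat) (X : seq (vec 'I_k)).
Implicit Types (x p : vec 'I_k) (g h w : 'cV[R]_(1 + k)).

Local Notation V := (fun j : 'I_(size X) => nth (@vzero _) X j).

Lemma conv_homog x : conv X x ->
  exists2 lam : 'I_(size X) -> R,
    forall j, 0 <= lam j & homog x = \sum_j lam j *: homog (V j).
Proof.
case=> lam [lam_ge0 [lam1 xE]]; exists lam => [j|]; first exact/RleP.
apply/rowP => i; rewrite /homog summxE -[i]splitK; case: (split i) => i' /=.
  rewrite row_mxEl ord1 mxE eqxx -[LHS]lam1; apply: eq_bigr => j _.
  by rewrite mxE row_mxEl mxE eqxx mulr1.
rewrite row_mxEr mxE xE; apply: eq_bigr => j _.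
by rewrite mxE row_mxEr mxE.
Qed.

Definition vanishing g : {set 'I_(size X)} := [set j | aff g (V j) == 0].

Definition face_homogs g :=
  homogs (fun j : 'I_#|vanishing g| => V (enum_val j)).

Definition nonneg_on_vertices g := forall j, 0 <= aff g (V j).

Lemma aff_conv_ge0 g x : nonneg_on_vertices g -> conv X x -> 0 <= aff g x.
Proof.
move=> g_ge0 /conv_homog[lam lam_ge0 xE].
rewrite /aff xE mulmx_suml summxE sumr_ge0 // => j _.
by rewrite -scalemxAl mxE mulr_ge0 ?lam_ge0 //; apply: g_ge0.
Qed.

(** A sum of nonnegative terms is zero only if each term is, so [x] puts weight only on points of
    [X] where [g] vanishes. *)
Lemma homog_face g x : nonneg_on_vertices g -> conv X x -> aff g x = 0 ->
  (homog x <= face_homogs g)%MS.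
Proof.
move=> g_ge0 /conv_homog[lam lam_ge0 xE] /eqP.
rewrite /aff xE mulmx_suml summxE psumr_eq0 => [/allP lam_g0|j _]; last first.
  by rewrite -scalemxAl mxE mulr_ge0 ?lam_ge0 //; apply: g_ge0.
apply: summx_sub => j _; have := lam_g0 j.
rewrite mem_index_enum -scalemxAl mxE mulf_eq0.
case/(_ erefl)/orP => [/eqP->|gj0]; first by rewrite scale0r sub0mx.
have zj : j \in vanishing g by rewrite inE.
apply: scalemx_sub; have := row_sub (enum_rank_in zj j) (face_homogs g).
by rewrite row_homogs enum_rankK_in.
Qed.

Lemma face_homogs_mul g h : vanishing g \subset vanishing h -> face_homogs g *m h = 0.
Proof.
move=> /subsetP sgh; apply/row_matrixP => j; rewrite row_mul row_homogs homog_mul row0.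
by have := sgh _ (enum_valP j); rewrite inE => /eqP->; rewrite raddf0.
Qed.

Lemma aff_face g h x : vanishing g \subset vanishing h ->
  (homog x <= face_homogs g)%MS -> aff h x = 0.
Proof.
move=> sgh /submxP[D xE].
by rewrite /aff xE -mulmxA face_homogs_mul // mulmx0 mxE.
Qed.

Lemma homog_conv x : conv X x -> (homog x <= homogs V)%MS.
Proof.
case/conv_homog => lam _ ->; apply: summx_sub => j _; apply: scalemx_sub.
by have := row_sub j (homogs V); rewrite row_homogs.
Qed.

(* If the face {g = 0} has codimension at least two in conv X, then some
   functional w vanishes on it and at p without vanishing on conv X; rotating
   g about the face along w until a new vertex is hit keeps p outside. *)
Lemma rotate_face g p : nonneg_on_vertices g ->
    (\rank (face_homogs g) + 1 < \rank (homogs V))%N ->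
  exists h, [/\ nonneg_on_vertices h, aff h p = aff g p &
    vanishing g \proper vanishing h].
Proof.
move=> g_ge0 rk; pose B := col_mx (face_homogs g) (homog p).
(* Appending [p] raises the rank by at most one, so by [rk] the rows of [B] cannot span all of
   [X]. *)
have [j0 nBj0] : exists j, ~~ (homog (V j) <= B)%MS.
  apply/existsP; rewrite -negb_forall; apply/negP => /forallP sVB.
  have /mxrankS : (homogs V <= B)%MS.
    by apply/row_subP => j; rewrite row_homogs; apply: sVB.
  rewrite leqNgt (leq_ltn_trans _ rk) // -addsmxE.
  apply: leq_trans (mxrank_adds_leqif _ _) _.
  by rewrite leq_add2l rank_leq_row.
have [w0 Bw0 w0j0] : exists2 w : 'cV_(1 + k), B *m w = 0 & aff w (V j0) != 0.
  move: nBj0; rewrite submxE => /eqP/rowP nz.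
  have /existsP[i nzi] : [exists i, (homog (V j0) *m cokermx B) 0 i != 0].
    rewrite -negb_forall; apply/negP => /forallP nz'; apply: nz => i.
    by rewrite [RHS]mxE; apply/eqP.
  exists (col i (cokermx B)); first by rewrite colE mulmxA mulmx_coker mul0mx.
  by rewrite /aff colE mulmxA -colE mxE.
have {w0 Bw0 w0j0} [w Bw wj0] : exists2 w : 'cV_(1 + k), B *m w = 0 & aff w (V j0) < 0.
  case: (ltrgtP (aff w0 (V j0)) 0) w0j0 => // [lt0|gt0] _; first by exists w0.
  exists (-1 *: w0); first by rewrite -scalemxAr Bw0 scaler0.
  by rewrite affZ mulN1r oppr_lt0.
move: Bw; rewrite mul_col_mx -col_mx0 => /eq_col_mx[face_w p_w].
(* For [w] negative at [V j], this is the [t] at which [g + t *: w] reaches zero there. The least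
   such [t] preserves nonnegativity and gains the vertex [j1]. *)
pose ratio j := aff g (V j) / - aff w (V j).
have [j1 wj1 min_j1] : exists2 j1, aff w (V j1) < 0 &
    forall j, aff w (V j) < 0 -> ratio j1 <= ratio j.
  have [] := @arg_minP _ _ _ j0 (fun j => aff w (V j) < 0) ratio wj0.
  by move=> j1 wj1 min_j1; exists j1.
have van_w j : j \in vanishing g -> aff w (V j) = 0.
  move=> zj; have := congr1 (row (enum_rank_in zj j)) face_w.
  rewrite row_mul row_homogs enum_rankK_in // row0 => e.
  by rewrite /aff e mxE.
exists (g + ratio j1 *: w); split=> [j||].
- rewrite affD affZ; case: (ltrP (aff w (V j)) 0) => [wj|wj].
    have := min_j1 j wj; rewrite {2}/ratio ler_pdivlMr ?oppr_gt0 //.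
    by rewrite mulrN lerNl; lra.
  apply: addr_ge0; first exact: g_ge0.
  by apply: mulr_ge0 wj; apply: divr_ge0; [apply: g_ge0 | rewrite oppr_ge0 ltW].
- by rewrite affD affZ (_ : aff w p = 0) ?mulr0 ?addr0 // /aff p_w mxE.
apply/properP; split.
  apply/subsetP => j zj; rewrite inE affD affZ van_w // mulr0 addr0.
  by move: zj; rewrite inE.
exists j1.
  rewrite inE affD affZ /ratio invrN mulrN mulNr -mulrA mulVf ?mulr1 ?subrr //.
  by rewrite lt_eqF.
by apply: contraTN wj1 => /van_w->; rewrite ltxx.
Qed.

(** Induction on the number of listed points off the face [g = 0]: as long as the face has
    codimension at least two, [rotate_face] enlarges it without changing the value at [p]; once
    rotation is impossible, the face is a facet. *)
Lemma polytope_facet (P : vec 'I_k -> Prop) g p :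
    (forall x, P x <-> conv X x) -> (forall x, P x -> 0 <= aff g x) ->
    P p -> aff g p != 0 ->
  exists F, [/\ is_facet P F, forall x, P x -> aff g x = 0 -> F x & ~ F p].
Proof.
move=> PE P_ge0 /PE Pp; have : nonneg_on_vertices g.
  by move=> j; apply/P_ge0/PE/conv_nth.
move: {P_ge0} (leqnn #|~: vanishing g|); move: {2}#|_| => n.
elim: n g => [|n IHn] g le_n g_ge0 gp.
  case/negP: gp; apply/eqP; have /setP van : ~: vanishing g = set0.
    by apply/eqP; rewrite -cards_eq0 -leqn0.
  have Vg0 j : aff g (V j) = 0.
    by have := van j; rewrite !inE => /negbFE/eqP.
  have [lam _ pE] := conv_homog Pp; rewrite /aff pE mulmx_suml summxE big1 // => j _.
  by rewrite -scalemxAl mxE; have := Vg0 j; rewrite /aff => ->; rewrite mulr0.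
have [rk|rk] := ltnP (\rank (face_homogs g) + 1) (\rank (homogs V)).
  have [h [h_ge0 hp /properP[/subsetP sgh [j hj gj]]]] := rotate_face p g_ge0 rk.
  have [|||F [facetF hF Fp]] := IHn h; rewrite ?hp //.
    rewrite -ltnS; apply: leq_trans le_n; apply: proper_card; apply/properP; split.
      by rewrite setCS; apply/subsetP.
    by exists j; rewrite !inE ?negbK; move: hj gj; rewrite !inE.
  exists F; split=> // x Px gx; apply: hF => //.
  apply: (@aff_face g); first exact/subsetP.
  by apply: homog_face => //; apply/PE.
exists (fun x => P x /\ aff g x = 0); split=> //; last first.
  by case=> _ gp0; rewrite gp0 eqxx in gp.
split.
  exists (fun i => - g (rshift 1 i) 0), (g 0 0); split=> x.
    move=> /PE Px; apply/RleP; rewrite -subr_ge0 -affE; exact: aff_conv_ge0.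
  split=> [[Px gx]|[Px gx]]; split=> //.
    by move: gx; rewrite affE => /eqP; rewrite subr_eq0 eq_sym => /eqP.
  by rewrite affE gx subrr.
exists (\rank (face_homogs g)); split; last first.
  apply: has_rank_homogs => [j|x [/PE Px gx]]; last exact: homog_face.
  have := enum_valP j; rewrite inE => /eqP ->; split=> //; apply/PE; exact: conv_nth.
rewrite (_ : _.+1 = \rank (homogs V)).
  apply: has_rank_homogs => [j|x /PE]; [apply/PE; exact: conv_nth | exact: homog_conv].
(* One inequality is the failure of the rotation condition; the other is strict because with equal
   row spaces [g] would vanish at [p]. *)
apply/eqP; rewrite eqn_leq -[X in _ && (_ <= X)%N]addn1 rk andbT.
apply: rank_ltmx; rewrite ltmxE; apply/andP; split.
  apply/row_subP => j; rewrite row_homogs; exact/homog_conv/conv_nth.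
apply/negP => sVg; case/eqP: gp; apply: (@aff_face g) => //.
exact: submx_trans (homog_conv Pp) sVg.
Qed.

End Facets.

(* The rectangle belonging to a facet F of the extension P pairs the
   inequalities whose face of P lies in F with the points having a preimage
   outside F. *)
Lemma xc_le_rectangles (I : finType) (Q : vec I -> Prop) m (U W : Type)
    (f : U -> vec I -> R) (v : W -> vec I) :
    xc_le Q m -> (forall u, affine (f u)) ->
    (forall u x, Q x -> 0 <= f u x) -> (forall w, Q (v w)) ->
  exists (A : 'I_m -> U -> Prop) (B : 'I_m -> W -> Prop),
    forall u w, f u (v w) != 0 <-> exists j, A j u /\ B j w.
Proof.
case=> k [P [[X PE] [[Fs [le_m facetFs]] [C QE]]]] aff_f f_ge0 Qv.
pose pr (x : vec 'I_k) : vec I := fun i => rsum (fun j => C i j * x j).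
have {}QE y : Q y <-> exists x, P x /\ y = pr x.
  split=> [/QE[x [Px yE]]|[x [Px ->]]]; last by apply/QE; exists x.
  by exists x; split=> //; apply: funext.
(* Valid inequalities of [Q] pull back along the projection to valid inequalities of [P]. *)
have aff_pr u : exists g, forall x, aff g x = f u (pr x).
  have [c [d fE]] := aff_f u.
  have [g gE] := aff_of_dot (fun j => \sum_i c i * C i j) d.
  exists g => x; rewrite gE fE !dotE; congr (_ - _).
  under eq_bigr => j _ do rewrite mulr_suml.
  rewrite exchange_big; apply: eq_bigr => i _; rewrite /pr rsumE mulr_sumr.
  by apply: eq_bigr => j _; rewrite -mulrA.
pose F (j : 'I_m) := nth (fun _ => False) Fs j.
exists (fun j u => forall x, P x -> f u (pr x) = 0 -> F j x).
exists (fun j w => exists x, [/\ P x, v w = pr x & ~ F j x]) => u w; split.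
  have /QE[x [Px vE]] := Qv w; rewrite vE => fux.
  have [g gE] := aff_pr u.
  have [|||G [facetG faceG Gx]] := @polytope_facet k X P g x PE; rewrite ?gE //.
    by move=> y Py; rewrite gE; apply/f_ge0/QE; exists y.
  have [j GE] := facetFs _ facetG.
  exists (widen_ord le_m j); split=> [y Py fy|].
    by apply/GE/faceG; rewrite ?gE.
  by exists x; split=> // /GE.
by case=> j [Aju [x [Px -> nFx]]]; apply/eqP => /(Aju _ Px).
Qed.

End Polytopes.

(** * The gadget *)

Section MaximalMatchingPolytope.

Import Order.TTheory GRing.Theory Num.Theory.
Local Open Scope ring_scope.

Lemma incidence_MM (T : finType) (E M : {set {set T}}) :
  is_maximal_matching E M -> MM E (incidence E M).
Proof.
move=> maxM; pose s := enum [set M' | is_maximal_matching E M'].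
have sM : M \in s by rewrite mem_enum inE.
have lt_i : (index M s < size (map (incidence E) s))%N by rewrite size_map index_mem.
have := conv_nth (Ordinal lt_i).
by rewrite /= (nth_map set0) ?index_mem // nth_index.
Qed.

Lemma affine_MM_ge0 (T : finType) (E : {set {set T}}) f x : affine f ->
    (forall M, is_maximal_matching E M -> 0 <= f (incidence E M)) ->
  MM E x -> 0 <= f x.
Proof.
move=> aff_f f_ge0; apply: affine_conv_ge0 => // j; have := ltn_ord j.
rewrite [X in (_ < X)%N]size_map => lt_j; rewrite (nth_map set0) //; apply: f_ge0.
by have := mem_nth set0 lt_j; rewrite mem_enum inE.
Qed.

(** The default 0 at non-edges makes the coordinates total in [s] and [t], in agreement with
    membership in a matching. *)
Definition link_coord (S T : finType) (adj : S -> T -> bool) s t :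
    vec (edge (links adj)) -> R :=
  fun x => if insub (link s t) is Some e then x e else 0.

Lemma affine_link_coord (S T : finType) (adj : S -> T -> bool) s t :
  affine (@link_coord _ _ adj s t).
Proof.
rewrite /link_coord; case: insub => [e|]; [exact: affine_coord | exact: affine_const].
Qed.

Lemma link_coord_incidence (S T : finType) (adj : S -> T -> bool) M s t :
    is_matching (links adj) M ->
  @link_coord _ _ adj s t (incidence (links adj) M) = (link s t \in M)%:R.
Proof.
case/andP=> /subsetP sM _; rewrite /link_coord; case: insubP => [e _ <-|/negP notE].
  by rewrite /incidence; case: ifP.
by case: (boolP (_ \in M)) => // /sM.
Qed.

End MaximalMatchingPolytope.

Arguments link_coord {S T} adj s t x.

Section Gadget.

Import Order.TTheory GRing.Theory Num.Theory.
Local Open Scope ring_scope.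

Variable n : nat.

(* An assignment b of truth values is read off a maximal matching as follows:
   [hub i] is matched either to [lit true i] or to [lit false i], so that
   [lit c i] is exposed iff [b i = c].  By maximality [probe true (i, j)], which
   sees [lit false i] and [lit true j], has to be matched unless [b i] and not
   [b j], and then only [aux (i, j)] is available.  [probe false (i, j)] absorbs
   [aux (i, j)] otherwise. *)
Definition gleft : finType := (bool * 'I_n + 'I_n * 'I_n)%type.
Definition gright : finType := ('I_n + bool * ('I_n * 'I_n))%type.

Definition lit (c : bool) (i : 'I_n) : gleft := inl (c, i).
Definition aux (e : 'I_n * 'I_n) : gleft := inr e.
Definition hub (i : 'I_n) : gright := inl i.
Definition probe (c : bool) (e : 'I_n * 'I_n) : gright := inr (c, e).

Definition gadget_adj (s : gleft) (t : gright) : bool :=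
  match s, t with
  | inl (c, i), inl i' => i == i'
  | inl (c, i), inr (c', e) => c' && (i == if c then e.2 else e.1)
  | inr e, inl _ => false
  | inr e, inr (_, e') => e == e'
  end.

(* Vanishes exactly on the matchings that cover every hub and avoid the edges
   between literals and probes, i.e., on those that encode an assignment. *)
Definition penalty (m : gleft -> gright -> R) : R :=
  (\sum_i (1 - m (lit true i) (hub i) - m (lit false i) (hub i)) +
  \sum_e (m (lit false e.1) (probe true e) + m (lit true e.2) (probe true e)))%R.

(* On the matching of an assignment b the summand at (i, j) is [b i * b j], whence
   the value is (1 - |a /\ b|)^2, the slack of the correlation polytope.  The
   other terms are at least - (2 n + n^2), so a positive penalty outweighs them. *)
Definition gap (a : pred 'I_n) (m : gleft -> gright -> R) : R :=
  (1 - 2 * (\sum_(i | a i) m (lit false i) (hub i)) +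
  \sum_(e | a e.1 && a e.2)
    (m (aux e) (probe true e) - 1 + m (lit false e.1) (hub e.1)) +
  (2 * n + n * n)%:R * penalty m)%R.

Section GapNonneg.

Variables (m : gleft -> gright -> bool) (a : pred 'I_n).
Hypotheses (m_adj : forall s t, m s t -> gadget_adj s t)
  (m_l : forall s s' t, m s t -> m s' t -> s = s')
  (m_cover : forall s t, gadget_adj s t ->
     [exists t', m s t'] || [exists s', m s' t]).

Let mR s t : R := (m s t)%:R.

(** An integral form of the penalty, so that a nonzero penalty is at least 1. The disjunction
    replaces a sum because a hub has at most one partner. *)
Definition penalty_nat : nat :=
  \sum_i ~~ (m (lit true i) (hub i) || m (lit false i) (hub i)) +
  \sum_e (m (lit false e.1) (probe true e) + m (lit true e.2) (probe true e)).

Lemma penaltyE : penalty mR = penalty_nat%:R.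
Proof.
rewrite /penalty /penalty_nat natrD !natr_sum; congr (_ + _); last first.
  by apply: eq_bigr => e _; rewrite natrD.
apply: eq_bigr => i _; rewrite /mR; case mt: (m _ _); case mf: (m _ _);
  rewrite /= ?subr0 ?subrr //.
by have := m_l mt mf.
Qed.

Lemma probe_matched e : penalty_nat = 0%N ->
    ~~ m (lit false e.1) (hub e.1) || m (lit false e.2) (hub e.2) ->
  m (aux e) (probe true e).
Proof.
move=> /eqP; rewrite addn_eq0 !sum_nat_eq0 => /andP[/forallP hubs /forallP probes].
have no_probe c e' : m (lit c (if c then e'.2 else e'.1)) (probe true e') = false.
  have := probes e'; rewrite addn_eq0 !eqb0 => /andP[/negPf nf /negPf nt].
  by case: c.
have by_aux s : m s (probe true e) -> m (aux e) (probe true e).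
  case: s => [[c i]|e'] ms.
    by have /eqP def_i := m_adj ms; have := no_probe c e; rewrite -def_i ms.
  by have /eqP def_e := m_adj ms; rewrite def_e in ms.
(* An exposed neighbour forces the probe to be matched: [lit false e.1] is exposed in the first
   case, and [lit true e.2] in the second, since its hub is taken by [lit false e.2]. *)
suff cover_lit c : (forall i, ~~ m (lit c (if c then e.2 else e.1)) (hub i)) ->
    m (aux e) (probe true e).
  case/orP => [free1|matched2]; [apply: (cover_lit false)|apply: (cover_lit true)] => i.
    apply/negP => mi; have /eqP def_i := m_adj mi; rewrite -def_i in mi.
    by rewrite mi in free1.
  apply/negP => mi; have /eqP def_i := m_adj mi; rewrite -def_i in mi.
  by have := m_l mi matched2.
move=> no_hub; have adj_e : gadget_adj (lit c (if c then e.2 else e.1)) (probe true e).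
  by rewrite /= eqxx.
have /orP[/existsP[[i|[c' e']] mt]|/existsP[s]] := m_cover adj_e; last exact: by_aux.
  by have /negP := no_hub i.
have /andP[c'T /eqP def_e'] := m_adj mt.
by have := no_probe c e'; rewrite -def_e' -[true]c'T mt.
Qed.

(** At penalty zero the gap is at least [(1 - k) ^+ 2]; otherwise the penalty term is at least
    [2 * n + n * n] and makes up for the rest. *)
Lemma gap_ge0 : 0 <= gap a mR.
Proof.
rewrite /gap penaltyE.
set k := \sum_(i | a i) _; set S := \sum_(e | _) _.
case: (posnP penalty_nat) => [pen0|pen_gt0].
  (* Let [x_i] be the value of [m] on [lit false i] and [hub i]. Expanding the square, each
     [x_i * x_j] is bounded by the summand of [S] at [(i, j)]: unless [x_i = 1] and [x_j = 0],
     [probe_matched] turns that summand into [x_i]. *)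
  suff: k * k <= S.
    by rewrite pen0 mulr0 addr0; have := sqr_ge0 (1 - k); rewrite expr2; lra.
  rewrite /k /S big_distrlr /= pair_big /=; apply: ler_sum => e _.
  have := @probe_matched e pen0; rewrite /mR.
  by case: (m (aux e) _); case: (m (lit false e.1) _);
    case: (m (lit false e.2) _) => /= matched; try lra; have := matched isT.
have le_k : k <= n%:R.
  apply: (@le_trans _ _ (\sum_(i < n) 1)); last by rewrite sumr_const card_ord.
  rewrite /k big_mkcond; apply: ler_sum => i _; rewrite /mR.
  have bound (c p : bool) : (if c then p%:R else 0) <= 1 :> R.
    by case: c; case: p => /=; lra.
  exact: bound.
have ge_S : - (n * n)%:R <= S.
  apply: (@le_trans _ _ (\sum_(e : 'I_n * 'I_n) -1)).
    by rewrite sumr_const card_prod card_ord mulNrn.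
  rewrite /S [X in _ <= X]big_mkcond; apply: ler_sum => e _; rewrite /mR.
  have bound (c p q : bool) : -1 <= (if c then p%:R - 1 + q%:R else 0) :> R.
    by case: c; case: p; case: q => /=; lra.
  exact: bound.
have : (2 * n + n * n)%:R <= (2 * n + n * n)%:R * penalty_nat%:R :> R.
  by rewrite -natrM ler_nat leq_pmulr.
rewrite natrD natrM; lra.
Qed.

End GapNonneg.

Section Assignment.

Variable b : pred 'I_n.

Definition assignment (s : gleft) (t : gright) : bool :=
  match s, t with
  | inl (c, i), inl i' => (i == i') && (b i != c)
  | inl _, inr _ => false
  | inr e, inl _ => false
  | inr e, inr (c, e') => (e == e') && (c == ~~ b e.1 || b e.2)
  end.

Lemma assignment_maximal : is_maximal_matching (links gadget_adj) (links assignment).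
Proof.
apply: links_maximal_matching.
- by move=> [[c i]|e] [i'|[c' e']] //= /andP[].
- move=> [[c i]|e] [i1|[c1 e1]] [i2|[c2 e2]] //=.
    by case/andP=> /eqP<- _ /andP[/eqP<-].
  by case/andP=> /eqP<- /eqP-> /andP[/eqP<- /eqP->].
- move=> [[c1 i1]|e1] [[c2 i2]|e2] [i|[c e]] //=.
    case/andP=> /eqP-> ne1 /andP[/eqP-> ne2]; congr (inl (_, _)).
    by case: (b i) c1 c2 ne1 ne2 => [] [] [].
  by case/andP=> /eqP-> _ /andP[/eqP->].
move=> [[c i]|e] [i'|[c' e']] //=.
- move=> /eqP <-; have [bc|bc] := eqVneq (b i) c.
    by right; exists (lit (~~ c) i); rewrite /= eqxx bc; case: (c).
  by left; exists (hub i); rewrite /= eqxx.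
- case/andP=> -> /eqP def_i; have [bc|bc] := eqVneq (b i) c; last first.
    by left; exists (hub i); rewrite /= eqxx.
  (* The exposed literal makes the implication from [b e'.1] to [b e'.2] true, so [aux e'] is
     matched to the true probe. *)
  right; exists (aux e'); rewrite /= eqxx /=.
  by move: bc; rewrite def_i; case: (c) => ->; rewrite ?orbT.
by move=> _; left; exists (probe (~~ b e.1 || b e.2) e); rewrite /= !eqxx.
Qed.

Lemma gap_assignment (a : pred 'I_n) :
  gap a (fun s t => (assignment s t)%:R) = (1 - (\sum_(i | a i) b i)%:R) ^+ 2.
Proof.
have pen0 : penalty (fun s t => (assignment s t)%:R) = 0.
  rewrite /penalty big1 => [|i _]; last by rewrite /= eqxx; case: (b i) => /=; lra.
  by rewrite add0r big1 // => e _; rewrite /= addr0.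
rewrite /gap pen0 mulr0 addr0 /=.
set k := (X in (1 - X) ^+ 2).
have -> : \sum_(i | a i) ((i == i) && (b i != false))%:R = k.
  rewrite /k natr_sum; apply: eq_bigr => i _; by rewrite eqxx; case: (b i).
suff -> : \sum_(e : 'I_n * 'I_n | a e.1 && a e.2)
    (((e == e) && (true == ~~ b e.1 || b e.2))%:R - 1 +
       ((e.1 == e.1) && (b e.1 != false))%:R) = k * k.
  have square (t : R) : 1 - 2 * t + t * t = (1 - t) ^+ 2 by ring.
  exact: square.
rewrite /k natr_sum big_distrlr /= pair_big /=; apply: eq_bigr => e _.
(* The implication from [p] to [q] has value [1 - p + p * q]. *)
have bools (p q : bool) :
    (true == ~~ p || q)%:R - 1 + (p != false)%:R = p%:R * q%:R :> R.
  by case: p; case: q => /=; ring.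
by rewrite !eqxx; apply: bools.
Qed.

End Assignment.

Lemma affine_gap a :
  affine (fun x : vec (edge (links gadget_adj)) =>
    gap a (fun s t => link_coord gadget_adj s t x)).
Proof.
have lc s t := affine_link_coord gadget_adj s t.
rewrite /gap /penalty; repeat (apply: affineD || apply: affineN || apply: affineZ ||
  (apply: affine_sum => ?) || apply: lc || apply: affine_const).
Qed.

Lemma gap_MM_ge0 a x : MM (links gadget_adj) x ->
  0 <= gap a (fun s t => link_coord gadget_adj s t x).
Proof.
apply: (affine_MM_ge0 (affine_gap a)) => M maxM.
have matM : is_matching (links gadget_adj) M by case/andP: maxM.
rewrite (_ : (fun s t => _) = fun s t => (link s t \in M)%:R).
  apply: gap_ge0 => [s t|s s' t|s t].
  - exact: matching_adj.
  - exact: matching_eql matM.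
  - exact: maximal_matching_cover.
by apply: funext => s; apply: funext => t; apply: link_coord_incidence.
Qed.

Lemma gap_incidence_assignment a b :
  gap a (fun s t => link_coord gadget_adj s t
    (incidence (links gadget_adj) (links (assignment b)))) =
  (1 - (\sum_(i | a i) b i)%:R) ^+ 2.
Proof.
rewrite -gap_assignment; congr gap; apply: funext => s; apply: funext => t.
rewrite link_coord_incidence ?mem_links //.
by case/andP: (assignment_maximal b).
Qed.

End Gadget.

(** * From bit strings to the lower bound *)

Lemma sum_nth_common n a b : size a = n -> size b = n ->
  \sum_(i < n | nth false a i) nth false b i = common a b.
Proof.
elim: n a b => [|n IHn] [|x a] [|y b] //=; first by rewrite big_ord0.
move=> [sa] [sb]; rewrite big_mkcond big_ord_recl /= -big_mkcond IHn //.
by rewrite /common /=; case: x.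
Qed.

Theorem theorem5 :
  exists (N : nat -> nat) (E : forall n : nat, {set {set 'I_(N n)}}),
    (forall n, simple_graph (E n)) /\
    (forall n, bipartite (E n)) /\
    (exists c d : nat, forall n, N n <= c * n ^ d + c) /\
    (forall c d : nat, exists n, ~ xc_le (MM (E n)) (c * n ^ d + c)).
Proof.
exists (fun n => #|{: gleft n + gright n}|), (fun n => links (@gadget_adj n)).
split; first by move=> n; apply: simple_links.
split; first by move=> n; apply: bipartite_links.
split.
  (* The number of vertices is [3 * n ^ 2 + 3 * n]. *)
  by exists 6, 2 => n; rewrite !card_sum !card_prod !card_ord card_bool; nia.
move=> c d; have [n lt_n] := poly_lt_exp c d; exists n => xc.
have [A [B AB]] := xc_le_rectangles xc
  (fun a : bitseq => @affine_gap n (fun i => nth false a i))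
  (fun a x => @gap_MM_ge0 n (fun i => nth false a i) x)
  (fun b : bitseq => incidence_MM (assignment_maximal (fun i : 'I_n => nth false b i))).
move: lt_n; rewrite ltnNge => /negP; apply.
(* The gap is 0 when [common a b = 1], so no rectangle contains the pair, and 1 when
   [common a b = 0], so some rectangle does. *)
apply: (rectangle_cover_bound
  (A := fun j a => `[< A j a >]) (B := fun j b => `[< B j b >])).
  move=> j a b sa sb ab1; apply/negP => /andP[/asboolP Aa /asboolP Bb].
  have /AB : exists j, A j a /\ B j b by exists j.
  rewrite gap_incidence_assignment sum_nth_common // ab1.
  by rewrite GRing.subrr GRing.expr0n eqxx.
move=> a b sa sb ab0; have [|j [Aj Bj]] := iffLR (AB a b).
  rewrite gap_incidence_assignment sum_nth_common // ab0.
  by rewrite GRing.subr0 GRing.expr1n GRing.oner_eq0.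
by exists j; apply/andP; split; apply/asboolP.
Qed.
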